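(* Let $\mathcal{U}\subseteq\mathbb{S}$ be a universe of Scoring games containing all numbers $s=\langle\emptyset^s\mid\emptyset^s\rangle$, $s\in\mathbb{R}$. If $\mathcal{U}$ is natural, then every game in $\mathcal{U}$ is stable.
   Context: Scoring games are built recursively: an atom $\emptyset^s$ ($s\in\mathbb{R}$) stands for an empty set of options carrying score $s$. Day-0 games are $\langle\emptyset^\ell\mid\emptyset^r\rangle$ with $\ell,r\in\mathbb{R}$; a game born by day $i+1$ is $\langle\mathcal{G}\mid\mathcal{H}\rangle$ where each of $\mathcal{G},\mathcal{H}$ is either a nonempty finite set of games born by day $i$ or a single atom. $\mathbb{S}$ is the set of all such games. $G^{\mathcal L},G^{\mathcal R}$ denote the Left/Right option sets (or atoms); a follower of $G$ is any game reachable from $G$ by a (possibly empty, not necessarily alternating) sequence of moves. The number $s$ denotes $\langle\emptyset^s\mid\emptyset^s\rangle$. Disjunctive sum: if $G=\langle\emptyset^{\ell_1}\mid\emptyset^{r_1}\rangle$, $H=\langle\emptyset^{\ell_2}\mid\emptyset^{r_2}\rangle$ then $G+H=\langle\emptyset^{\ell_1+\ell_2}\mid\emptyset^{r_1+r_2}\rangle$; otherwise $G+H$ has Left options $G^{L}+H$, $G+H^{L}$ (over all existing Left options), and if neither $G$ nor $H$ has a Left option the Left side is the atom $\emptyset^{\ell_1+\ell_2}$ where $\emptyset^{\ell_1},\emptyset^{\ell_2}$ are the Left atoms of $G,H$; symmetrically for Right. The conjugate $\sim\! G$ swaps roles recursively: $\sim\!\langle\emptyset^\ell\mid\emptyset^r\rangle=\langle\emptyset^{-r}\mid\emptyset^{-\ell}\rangle$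 and in general Left options of $\sim\! G$ are $\sim\! G^{R}$, Right options are $\sim\! G^{L}$, with atoms $\emptyset^s$ becoming $\emptyset^{-s}$ on the opposite side. A universe is a set of Scoring games closed under disjunctive sum, under taking options, and under conjugation. Left-score and Right-score: $Ls(G)=\ell$ if $G^{\mathcal L}=\emptyset^\ell$, else $Ls(G)=\max_{G^L} Rs(G^L)$; $Rs(G)=r$ if $G^{\mathcal R}=\emptyset^r$, else $Rs(G)=\min_{G^R}Ls(G^R)$. For $G,H$ in a universe $\mathcal{U}$, $G\geqslant H$ means $Ls(G+X)\geqslant Ls(H+X)$ and $Rs(G+X)\geqslant Rs(H+X)$ for all $X\in\mathcal{U}$. Let $\mathbb{Np}$ be the set of short Normal-play games (game forms $\{G^{\mathcal L}\mid G^{\mathcal R}\}$ with finite option sets, last player to move wins), with its usual order $G\geqslant H$ iff Left wins $G-H$ moving second. The Normal-play mapping $\zeta:\mathbb{Np}\to\mathcal{U}$ sends $G$ to the Scoring game $\zeta(G)$ obtained by replacing every empty set of options in every follower of $G$ by the atom $\emptyset^0$. $\mathcal U$ is natural if $\zeta$ is an order-embedding: for all $G,H\in\mathbb{Np}$, $G\leqslant H$ iff $\zeta(G)\leqslant\zeta(H)$ in $\mathcal U$. A game is atomic if at least one of $G^{\mathcal L},G^{\mathcal R}$ is an atom. An atomic game $G$ is stable if $Ls(G)\leqslant Rs(G)$; a game is stable if every atomic follower of it (including itself) is stable. *)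

(* Defs.v *)
From mathcomp Require Import all_boot all_order all_algebra.
From mathcomp Require Import boolp classical_sets reals.
From Stdlib Require List.

Set Implicit Arguments.
Unset Strict Implicit.
Unset Printing Implicit Defensive.

Import Order.TTheory GRing.Theory Num.Theory.
Local Open Scope ring_scope.

(* One side of a game form: either an atom carrying a score, or a nonempty
   finite collection of options, [Opts x xs] standing for {x} union xs. *)
Variant side (R T : Type) : Type :=
| Atom of R
| Opts of T & seq T.

Arguments Atom {R T} _.
Arguments Opts {R T} _ _.

Section Side.
Variables R T : Type.
Implicit Types A B : side R T.

Definition options A : seq T :=
  match A with Atom _ => [::] | Opts x xs => x :: xs end.

Definition is_atom A : bool :=
  match A with Atom _ => true | Opts _ _ => false end.

Definition side_map (f : R -> R) (g : T -> T) A : side R T :=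
  match A with
  | Atom s => Atom (f s)
  | Opts x xs => Opts (g x) [seq g y | y <- xs]
  end.

Definition score (pick : R -> R -> R) (f : T -> R) A : R :=
  match A with
  | Atom s => s
  | Opts x xs => foldr pick (f x) [seq f y | y <- xs]
  end.

End Side.

(* In the sum G + H, [f] maps an option G' of G to G' + H and [g] maps an
   option H' of H to G + H'. *)
Definition side_add (R : zmodType) (T : Type) (f g : T -> T)
    (A B : side R T) : side R T :=
  match A, B with
  | Atom a, Atom b => Atom (a + b)
  | Opts x xs, Atom _ => Opts (f x) [seq f u | u <- xs]
  | Atom _, Opts y ys => Opts (g y) [seq g v | v <- ys]
  | Opts x xs, Opts y ys =>
      Opts (f x) ([seq f u | u <- xs] ++ g y :: [seq g v | v <- ys])
  end.

Definition side_same (R : eqType) (T : Type) (e : T -> T -> bool)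
    (A B : side R T) : bool :=
  match A, B with
  | Atom a, Atom b => a == b
  | Opts x xs, Opts y ys =>
         all (fun u => has (fun v => e u v) (y :: ys)) (x :: xs)
      && all (fun v => has (fun u => e u v) (x :: xs)) (y :: ys)
  | _, _ => false
  end.

(* The inductive closure yields exactly the games born by some finite day. *)
Inductive sgame (R : Type) : Type :=
  SGame of side R (sgame R) & side R (sgame R).

Section ScoringGames.
Variable R : realType.
Implicit Types G H X : sgame R.

Definition left_side G : side R (sgame R) := let: SGame l _ := G in l.
Definition right_side G : side R (sgame R) := let: SGame _ r := G in r.

(* Equality of games when option collections are read, hereditarily, as sets:
   order and repetitions in the lists are ignored. *)
Fixpoint same_game G H {struct G} : bool :=
  let: SGame l1 r1 := G in
  let: SGame l2 r2 := H in
  side_same same_game l1 l2 && side_same same_game r1 r2.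

Definition number_game (s : R) : sgame R := SGame (Atom s) (Atom s).

Fixpoint sadd G : sgame R -> sgame R :=
  fix sadd_G H : sgame R :=
    let: SGame l1 r1 := G in
    let: SGame l2 r2 := H in
    SGame (side_add (fun G' => sadd G' H) sadd_G l1 l2)
          (side_add (fun G' => sadd G' H) sadd_G r1 r2).

Fixpoint sconj G : sgame R :=
  let: SGame l r := G in
  SGame (side_map -%R sconj r) (side_map -%R sconj l).

Fixpoint Ls G : R :=
  let: SGame l _ := G in score Num.max Rs l
with Rs G : R :=
  let: SGame _ r := G in score Num.min Ls r.

Definition is_option G H : Prop :=
  List.In H (options (left_side G)) \/ List.In H (options (right_side G)).

Inductive follower G : sgame R -> Prop :=
| follower_refl : follower G G
| follower_option H K : follower G H -> is_option H K -> follower G K.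

(* [universe_same] says that U is a set of games, i.e. does not depend on the
   way sets of options are listed. *)
Record universe (U : set (sgame R)) : Prop := Universe {
  universe_same : forall G H, same_game G H -> U G -> U H;
  universe_add : forall G H, U G -> U H -> U (sadd G H);
  universe_option : forall G H, U G -> is_option G H -> U H;
  universe_conj : forall G, U G -> U (sconj G)
}.

Definition sge (U : set (sgame R)) G H : Prop :=
  forall X, U X ->
    Ls (sadd H X) <= Ls (sadd G X) /\ Rs (sadd H X) <= Rs (sadd G X).

Definition atomic G : bool := is_atom (left_side G) || is_atom (right_side G).

Definition stable G : Prop :=
  forall H, follower G H -> atomic H -> Ls H <= Rs H.

End ScoringGames.

Inductive npgame : Type := NpGame of seq npgame & seq npgame.

Fixpoint np_opp (G : npgame) : npgame :=
  let: NpGame l r := G in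
  NpGame [seq np_opp x | x <- r] [seq np_opp x | x <- l].

Fixpoint np_add (G : npgame) : npgame -> npgame :=
  fix np_add_G (H : npgame) : npgame :=
    let: NpGame l1 r1 := G in
    let: NpGame l2 r2 := H in
    NpGame ([seq np_add x H | x <- l1] ++ [seq np_add_G y | y <- l2])
           ([seq np_add x H | x <- r1] ++ [seq np_add_G y | y <- r2]).

Fixpoint left_wins_first (G : npgame) : bool :=
  let: NpGame l _ := G in has left_wins_second l
with left_wins_second (G : npgame) : bool :=
  let: NpGame _ r := G in all left_wins_first r.

Definition np_ge (G H : npgame) : bool := left_wins_second (np_add G (np_opp H)).

Section Natural.
Variable R : realType.

Fixpoint zeta (G : npgame) : sgame R :=
  let zeta_side s :=
    if s is x :: xs then Opts (zeta x) [seq zeta y | y <- xs] else Atom 0 in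
  let: NpGame l r := G in SGame (zeta_side l) (zeta_side r).

(* The first conjunct says that zeta takes its values in U. *)
Definition natural (U : set (sgame R)) : Prop :=
  (forall G, U (zeta G)) /\
  (forall G H, np_ge H G <-> sge U (zeta H) (zeta G)).

End Natural.

(* Main.v *)
Require Import Defs.
From mathcomp Require Import all_boot all_order all_algebra.
From mathcomp Require Import boolp classical_sets reals.

(** In normal play [1 = {0|}] is at least [0].  If the Left side of [H] is an
    atom, then Left's only move in [zeta 1 + H] is to [zeta 0 + H = H], so
    testing [zeta 1 >= zeta 0] against [H] gives [Ls H <= Rs H].  The
    Right-atomic case is the mirror image, with [-1 <= 0]. *)

Import Order.TTheory GRing.Theory Num.Theory.
Local Open Scope ring_scope.

Definition np_zero : npgame := NpGame [::] [::].
Definition np_one : npgame := NpGame [:: np_zero] [::].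
Definition np_minus_one : npgame := NpGame [::] [:: np_zero].

Section StableFollowers.
Variable R : realType.
Implicit Types (G H : sgame R) (U : set (sgame R)).

(** Options lie in lists nested inside [side]; a guarded [fix] with inner list inductions reaches
    each of them. *)
Lemma sgame_option_ind (P : sgame R -> Prop) :
  (forall G, (forall H, is_option G H -> P H) -> P G) -> forall G, P G.
Proof.
move=> stepP; fix IH 1 => -[l r]; apply: stepP => H [].
- case: l => [a []|x xs [<-|]]; first exact: IH.
  by elim: xs => [[]|y ys IHys [<-|]]; [exact: IH | exact: IHys].
- case: r => [a []|x xs [<-|]]; first exact: IH.
  by elim: xs => [[]|y ys IHys [<-|]]; [exact: IH | exact: IHys].
Qed.

(** [g] is constrained only on the options of [A], which is all that induction on games provides
    when [g] is addition of zero. *)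
Lemma side_add_atom0 (f g : sgame R -> sgame R) (A : side R (sgame R)) :
  (forall x, List.In x (options A) -> g x = x) -> side_add f g (Atom 0) A = A.
Proof.
case: A => [a|x xs] /= gE; first by rewrite add0r.
rewrite gE; last by left.
have {gE} : forall y, List.In y xs -> g y = y by move=> y xs_y; apply: gE; right.
elim: xs => //= y ys IHys gE; congr (Opts x (_ :: _)); first by apply: gE; left.
by have [] := IHys (fun z ys_z => gE z (or_intror ys_z)).
Qed.

Lemma sadd_zeta_zero G : sadd (zeta R np_zero) G = G.
Proof.
elim/sgame_option_ind: G => -[l r] IH.
by congr SGame; apply: side_add_atom0 => x x_opt; apply: IH; [left | right].
Qed.

Lemma universe_follower U G H : universe U -> U G -> follower G H -> U H.
Proof.
move=> U_universe UG; elim=> // {}H K _ UH; exact: universe_option UH.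
Qed.

Lemma sge_one_zero_stable U H : sge U (zeta R np_one) (zeta R np_zero) ->
  U H -> is_atom (left_side H) -> Ls H <= Rs H.
Proof.
move=> ge10 UH; have [le_Ls _] := ge10 H UH; rewrite sadd_zeta_zero in le_Ls.
case: H {UH} le_Ls => [[l|//] r] le_Ls _; apply: le_trans le_Ls _.
(* A maximum over one option computes to the [Rs] of that option, here [sadd (zeta R np_zero) H];
   with [H] rewritten as this sum, both sides are convertible. *)
rewrite -[leRHS]/(Rs (SGame (Atom l) r)) -[in leRHS](sadd_zeta_zero (SGame _ r)).
exact: lexx.
Qed.

Lemma sge_zero_minus_one_stable U H :
  sge U (zeta R np_zero) (zeta R np_minus_one) ->
  U H -> is_atom (right_side H) -> Ls H <= Rs H.
Proof.
move=> ge0m1 UH; have [_ le_Rs] := ge0m1 H UH; rewrite sadd_zeta_zero in le_Rs.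
case: H {UH} le_Rs => [l [r|//]] le_Rs _; apply: le_trans le_Rs.
rewrite -[leLHS]/(Ls (SGame l (Atom r))) -[in leLHS](sadd_zeta_zero (SGame l _)).
exact: lexx.
Qed.

End StableFollowers.

Theorem theorem1 (R : realType) (U : set (sgame R))
    (U_universe : universe U) (U_numbers : forall s : R, U (number_game s))
    (U_natural : natural U) :
  forall G : sgame R, U G -> stable G.
Proof.
move=> G UG H /(universe_follower _ _ _ _ U_universe UG) UH.
have [_ zeta_ge] := U_natural.
case/orP.
(* What remains is [np_ge np_one np_zero], which evaluates to [true]; likewise
   [np_ge np_zero np_minus_one] in the other case. *)
- exact/(sge_one_zero_stable _ _ _ _ UH)/zeta_ge.
- exact/(sge_zero_minus_one_stable _ _ _ _ UH)/zeta_ge.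
Qed.
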